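(* Let $X$ be a $T_0$ space. Then $$\mathcal S_c(X)\subseteq \mathcal D_c^\omega(X)\subseteq \mathsf{RD}_\omega(X)\subseteq \mathsf{WD}_\omega(X)\subseteq \mathsf{Irr}_c(X).$$
   Context: Let $X$ be a $T_0$ space with specialization order $x\leq y$ iff $x\in\overline{\{y\}}$. A subset is saturated if it is an intersection of open sets; $\mathsf K(X)$ is the set of nonempty compact saturated subsets of $X$. A family of sets is filtered if it is nonempty and any two members contain a third member of the family. A $T_0$ space $Y$ is $\omega$-well-filtered if for every countable filtered family $\{K_i : i<\omega\}\subseteq\mathsf K(Y)$ and every open $U\subseteq Y$, $\bigcap_{i<\omega}K_i\subseteq U$ implies $K_{i_0}\subseteq U$ for some $i_0<\omega$. $\mathcal S_c(X)=\{\overline{\{x\}} : x\in X\}$. $\mathcal D_c^\omega(X)=\{\overline D : D\subseteq X \text{ countable and directed in the specialization order}\}$ (directed sets are nonempty). $\mathsf{RD}_\omega(X)$ ($\omega$-Rudin sets) is the set of all nonempty closed $A\subseteq X$ for which there is a countable filtered family $\mathcal K\subseteq\mathsf K(X)$ such that $A$ is minimal (under inclusion) among the closed subsets of $X$ that meet every member of $\mathcal K$. $\mathsf{WD}_\omega(X)$ ($\omega$-well-filtered determined closed sets) is the set of all closed $A\subseteq X$ such that for every continuous map $f:X\to Y$ to an $\omega$-well-filtered space $Y$ there is a unique $y_A\in Y$ with $\overline{f(A)}=\overline{\{y_A\}}$. $\mathsf{Irr}_c(X)$ is the set of all irreducible closed subsets of $X$, where a nonempty set $A$ is irreducible if for all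 closed $F_1,F_2$, $A\subseteq F_1\cup F_2$ implies $A\subseteq F_1$ or $A\subseteq F_2$. *)

(* Defs.v *)
From mathcomp Require Import all_boot all_order.
From mathcomp Require Import boolp classical_sets functions cardinality topology.

Set Implicit Arguments.
Unset Strict Implicit.
Unset Printing Implicit Defensive.

Local Open Scope classical_set_scope.

Section SpecializationOrder.
Context {X : topologicalType}.

Definition spec_le (x y : X) : Prop := closure [set y] x.

Definition spec_directed (D : set X) : Prop :=
  D !=set0 /\
  forall x y, D x -> D y -> exists z, [/\ D z, spec_le x z & spec_le y z].

Definition saturated (A : set X) : Prop :=
  exists2 O : set (set X), O `<=` open & A = \bigcap_(U in O) U.

End SpecializationOrder.

Definition filtered_family {T : Type} (F : set (set T)) : Prop :=
  F !=set0 /\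
  forall K1 K2, F K1 -> F K2 -> exists2 K3, F K3 & K3 `<=` K1 `&` K2.

Section ClosedSetFamilies.
Variable X : topologicalType.

Definition KK : set (set X) :=
  [set K | [/\ K !=set0, compact K & saturated K]].

(* The family is indexed by nat, possibly with repetitions, so finite families
   are included. *)
Definition omega_well_filtered : Prop :=
  kolmogorov_space X /\
  forall K : nat -> set X,
    (forall i, KK (K i)) -> filtered_family (range K) ->
    forall U : set X, open U -> \bigcap_i K i `<=` U -> exists i, K i `<=` U.

Definition Sc : set (set X) := [set closure [set x] | x in [set: X]].

Definition Dc_omega : set (set X) :=
  [set closure D | D in [set D : set X | countable D /\ spec_directed D]].

Definition closed_meeting (F : set (set X)) : set (set X) :=
  [set A | closed A /\ forall K, F K -> A `&` K !=set0].

Definition RD_omega : set (set X) :=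
  [set A | [/\ A !=set0, closed A &
    exists F : set (set X),
      [/\ countable F, F `<=` KK, filtered_family F, closed_meeting F A &
          forall B, closed_meeting F B -> B `<=` A -> B = A]]].

Definition Irr_c : set (set X) :=
  [set A | [/\ closed A, A !=set0 &
    forall F1 F2 : set X, closed F1 -> closed F2 ->
      A `<=` F1 `|` F2 -> A `<=` F1 \/ A `<=` F2]].

End ClosedSetFamilies.

Arguments KK X : clear implicits.
Arguments Sc X : clear implicits.
Arguments Dc_omega X : clear implicits.
Arguments RD_omega X : clear implicits.
Arguments Irr_c X : clear implicits.

Definition WD_omega (X : topologicalType) : set (set X) :=
  [set A | closed A /\
    forall (Y : topologicalType) (f : X -> Y),
      omega_well_filtered Y -> continuous f ->
      exists! y : Y, closure (f @` A) = closure [set y]].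

Arguments WD_omega X : clear implicits.

(* Main.v *)
Require Import Defs.
From HB Require Import structures.
From mathcomp Require Import all_boot all_order.
From mathcomp Require Import boolp classical_sets functions cardinality topology.

Set Implicit Arguments.
Unset Strict Implicit.
Unset Printing Implicit Defensive.

Local Open Scope classical_set_scope.

(** A directed set [D] makes the principal upsets of its points a filtered
    family of compact saturated sets, and [closure D] is the least closed set
    meeting all of them; this gives the second inclusion.

    For the third, let [A] be minimal for the filtered family [F] and let
    [f : X -> Y] be continuous with [Y] omega-well-filtered.  The upsets of the
    sets [f @` (K `&` A)], [K] in [F], form a countable filtered family in
    [KK Y], and none of them misses [closure (f @` A)]; well-filteredness then
    yields a point [y] of [closure (f @` A)] in all of them.  So the closed set
    [A `&` f @^-1` closure [set y]] still meets every [K] in [F], hence equals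
    [A] by minimality, which says that [closure (f @` A)] is the closure of
    [y].

    For the last inclusion, a finite T0 space is omega-well-filtered, so finite
    spaces can serve as test spaces.  Two closed sets [F1], [F2] covering [A]
    define a continuous map from [X] to the square of the Sierpinski space,
    recording non-membership in [F1] and in [F2].  The image of [A] misses the top corner,
    which is open, and if [A] lies in neither [F1] nor [F2] then that image
    contains two points whose only common upper bound is the top corner, so it
    has no generic point.

    A singleton being directed, the first inclusion is immediate. *)

(** * The specialization order and upsets *)

Section Specialization.
Context {X : topologicalType}.
Implicit Types (x y : X) (A U C : set X).

Lemma closure_sub_closed A C : closed C -> A `<=` C -> closure A `<=` C.
Proof. by move=> clC AC; rewrite closureE; exact: smallest_sub. Qed.

Lemma spec_le_refl x : spec_le x x.
Proof. exact: (@subset_closure _ [set x]). Qed.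

Lemma spec_le_closed C x y : closed C -> C y -> spec_le x y -> C x.
Proof. by move=> clC Cy; apply: closure_sub_closed => // _ ->. Qed.

Lemma spec_le_open U x y : open U -> U x -> spec_le x y -> U y.
Proof.
move=> oU Ux xy; apply: contrapT => nUy.
by have /(_ Ux) := spec_le_closed (open_closedC oU) nUy xy.
Qed.

Lemma spec_le_trans x y z : spec_le x y -> spec_le y z -> spec_le x z.
Proof. by move=> xy yz; apply: spec_le_closed xy => //; exact: closed_closure. Qed.

Lemma kolmogorov_closure1_inj : kolmogorov_space X ->
  forall x y, closure [set x] = closure [set y] -> x = y.
Proof.
move=> T0 x y xy; apply/eqP/negPn/negP => /T0[A].
have xley : spec_le x y by rewrite /spec_le -xy; exact: spec_le_refl.
have ylex : spec_le y x by rewrite /spec_le xy; exact: spec_le_refl.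
case=> -[]; rewrite !inE => nA.
  by have [_ [-> ?]] := xley _ nA.
by have [_ [-> ?]] := ylex _ nA.
Qed.

Definition upset A : set X := [set y | exists2 x, A x & spec_le x y].

Lemma sub_upset A : A `<=` upset A.
Proof. by move=> x Ax; exists x => //; exact: spec_le_refl. Qed.

Lemma upsetS A B : A `<=` B -> upset A `<=` upset B.
Proof. by move=> AB y [x /AB Bx xy]; exists x. Qed.

Lemma upset_open A U : open U -> A `<=` U -> upset A `<=` U.
Proof. by move=> oU AU y [x /AU Ux]; exact: spec_le_open. Qed.

(** A point outside [upset A] is separated from it by the complement of its own
    closure, so [upset A] is the intersection of the open sets containing [A]. *)
Lemma saturated_upset A : saturated (upset A).
Proof.
exists [set U | open U /\ A `<=` U]; first by move=> U [].
apply/seteqP; split=> [y Ay U [oU AU]|y]; first exact: upset_open Ay.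
apply: contraPP => nAy.
move=> /(_ (~` closure [set y])); apply; last exact: spec_le_refl.
split; first exact/closed_openC/closed_closure.
by move=> x Ax xy; apply: nAy; exists x.
Qed.

(** Open sets are upsets, so a property holding near a point holds near that
    point together with all its specialization upper bounds. *)
Lemma compact_upset A : compact A -> compact (upset A).
Proof.
rewrite !compact_near_coveringP => cA I F P FF nearP.
pose Q i x := forall y, spec_le x y -> P i y.
have : \forall i \near F, A `<=` Q i.
  apply: cA => x Ax; have [[U G] /= [Ux FG] UG] := nearP x (sub_upset Ax).
  exists (U°, G); first by split=> //; exact: nbhs_interior.
  move=> [z i] /= [Uz Gi] y zy; apply: (UG (y, i)); split=> //.
  apply: interior_subset; exact: spec_le_open (@open_interior _ _) Uz zy.
by apply: filterS => i AQ y [x /AQ]; exact.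
Qed.

Lemma KK_upset A : A !=set0 -> compact A -> KK X (upset A).
Proof.
move=> [x Ax] cA; split; last exact: saturated_upset.
  by exists x; exact: sub_upset.
exact: compact_upset.
Qed.

End Specialization.

(** * Closures of countable directed sets are omega-Rudin *)

Lemma Sc_sub_Dc_omega (X : topologicalType) : Sc X `<=` Dc_omega X.
Proof.
move=> _ [x _ <-]; exists [set x] => //; split; first exact: countable1.
split; first by exists x.
by move=> _ _ -> ->; exists x; split=> //; exact: spec_le_refl.
Qed.

(** The family of upsets of the points of [D] is filtered because [D] is directed.
    A closed set is a downset, so one that meets the upset of [d] contains [d]:
    whence minimality of [closure D]. *)
Lemma Dc_omega_sub_RD_omega (X : topologicalType) : Dc_omega X `<=` RD_omega X.
Proof.
move=> _ [D [cD [[d0 Dd0] dirD]] <-].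
split; [by exists d0; exact: subset_closure|exact: closed_closure|].
exists [set upset [set d] | d in D]; split.
- exact: card_le_trans (card_image_le _ _) cD.
- move=> _ [d _ <-]; apply: KK_upset; first by exists d.
  exact: compact_set1.
- split; first by exists (upset [set d0]), d0.
  move=> _ _ [d Dd <-] [e De <-].
  have [z [Dz dz ez]] := dirD d e Dd De.
  exists (upset [set z]); first by exists z.
  by move=> y [_ -> zy]; split; [exists d|exists e] => //;
    apply: spec_le_trans zy.
- split; first exact: closed_closure.
  move=> _ [d Dd <-]; exists d; split; first exact: subset_closure.
  exact: sub_upset.
- move=> B [clB BD] BsubD; apply/seteqP; split=> //.
  apply: closure_sub_closed => // d Dd.
  have [y [By [_ -> dy]]] := BD _ (ex_intro2 _ _ d Dd erefl).
  exact: spec_le_closed dy.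
Qed.

(** * Omega-Rudin sets are determined by omega-well-filtered spaces *)

Lemma countable_range T (F : set T) : countable F -> F !=set0 ->
  exists u : nat -> T, range u = F.
Proof.
move=> /pfcard_geP[->[]//|[u] _]; exists u.
by apply/seteqP; split=> [_ [n _ <-]|]; [exact: funS|exact: surj].
Qed.

(** The point determined by [f] exists because the family of upsets of the
    images [f @` (K i `&` A)] cannot miss [closure (f @` A)]. *)
Lemma RD_omega_sub_WD_omega (X : topologicalType) : RD_omega X `<=` WD_omega X.
Proof.
move=> A [A0 clA [F [cF FK [F0 Ffil] [_ FA] Amin]]]; split=> // Y f [T0 wf] fc.
have [K rK] := countable_range cF F0.
have FKi i : F (K i) by rewrite -rK; exists i.
pose L i := upset (f @` (K i `&` A)).
have KLi i : KK Y (L i).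
  apply: KK_upset.
    by have [x [Ax Kx]] := FA _ (FKi i); exists (f x), x.
  apply: continuous_compact; first exact: continuous_subspaceT.
  by apply: compact_closedI => //; have [] := FK _ (FKi i).
have Lfil : filtered_family (range L).
  split; first by exists (L 0), 0.
  move=> _ _ [i _ <-] [j _ <-].
  have [K3] := Ffil _ _ (FKi i) (FKi j).
  rewrite -rK => -[k _ <-] kij; exists (L k); first by exists k.
  by rewrite subsetI; split; apply: upsetS; apply: image_subset; apply: setSI;
    move=> x /kij[].
have [y [Ly cly]] : (\bigcap_i L i) `&` closure (f @` A) !=set0.
  apply/set0P/negP => /eqP/disjoints_subset LA.
  have [i] := wf L KLi Lfil _ (closed_openC (@closed_closure _ _)) LA.
  have [x [Ax Kx]] := FA _ (FKi i).
  move=> /(_ (f x)); apply; first by apply: sub_upset; exists x.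
  by apply: subset_closure; exists x.
have fA : f @` A `<=` closure [set y].
  rewrite -(Amin (A `&` f @^-1` closure [set y])) => [_ [x [_ fx] <-]//| |x []//].
  split.
    apply: closedI => //; have /continuous_closedP := fc; apply.
    exact: closed_closure.
  rewrite -rK => _ [i _ <-].
  by have [_ [x [Kx Ax] <-] fxy] := Ly i I; exists x.
have clfA : closure (f @` A) = closure [set y].
  apply/seteqP; split; apply: closure_sub_closed => //; try exact: closed_closure.
  by move=> _ ->.
exists y; split=> // z; rewrite clfA; exact: kolmogorov_closure1_inj.
Qed.

(** * Testing irreducibility with the Sierpinski square *)

(** Each point is excluded by some member; filteredness merges finitely many such
    members into one. *)
Lemma filtered_family_avoid (T : eqType) (F : set (set T)) (s : seq T) :
  filtered_family F -> (forall y, y \in s -> ~ (\bigcap_(K in F) K) y) ->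
  exists2 K, F K & forall y, y \in s -> ~ K y.
Proof.
move=> [[K0 FK0] Ffil]; elim: s => [_|x s IH xs]; first by exists K0.
have [|K FK Ks] := IH; first by move=> y ys; apply: xs; rewrite inE ys orbT.
have /existsNP[K' /not_implyP[FK' nK'x]] := xs x (mem_head _ _).
have [K3 FK3 K3s] := Ffil _ _ FK FK'; exists K3 => // y.
by rewrite inE => /predU1P[-> /K3s[]|/Ks nKy /K3s[]].
Qed.

(** The points outside [U] are finitely many and all lie outside the
    intersection of the family, so a single member avoids them all. *)
Lemma finite_omega_well_filtered (Y : topologicalType) :
  finite_set [set: Y] -> kolmogorov_space Y -> omega_well_filtered Y.
Proof.
move=> /finite_seqP[s Ys] T0; split=> // K _ Kfil U _ KU.
have [||_ [i _ <-] Kis] := @filtered_family_avoid _ (range K)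
    [seq y <- s | `[< ~ U y >]] => //.
  move=> y; rewrite mem_filter => /andP[/asboolP nUy _] Ky; apply/nUy/KU.
  by move=> i _; apply: Ky; exists i.
exists i => y Ky; apply: contrapT => nUy; apply: Kis Ky.
have : [set: Y] y by [].
by rewrite Ys /= mem_filter => ->; rewrite andbT; exact/asboolP.
Qed.

(** Product of two copies of the Sierpinski space, [true] being its open point.
    A separate type keeps this topology apart from the discrete one that
    [bool * bool] carries; its opens are the upsets of the coordinatewise
    order. *)
Definition square : Type := (bool * bool)%type.

HB.instance Definition _ := Choice.on square.

Definition square_le (p q : square) := (p.1 ==> q.1) && (p.2 ==> q.2).

Definition square_open : set_system square :=
  [set U | forall p q, square_le p q -> U p -> U q].

Lemma square_openT : square_open setT. Proof. by []. Qed.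

Lemma square_openI : setI_closed square_open.
Proof. by move=> U V oU oV p q pq [Up Vp]; split; [exact: oU Up|exact: oV Vp]. Qed.

Lemma square_open_bigU (I : Type) (U : I -> set square) :
  (forall i, square_open (U i)) -> square_open (\bigcup_i U i).
Proof. by move=> oU p q pq [i _ Up]; exists i => //; exact: oU Up. Qed.

HB.instance Definition _ := isOpenTopological.Build square
  square_openT square_openI square_open_bigU.

Lemma square_le_refl (p : square) : square_le p p.
Proof. by rewrite /square_le !implybb. Qed.

Lemma square_le_trans (p q r : square) :
  square_le p q -> square_le q r -> square_le p r.
Proof. by move: p q r => [[] []] [[] []] [[] []]. Qed.

Lemma nbhs_square (p : square) (W : set square) :
  nbhs p W <-> square_le p `<=` W.
Proof.
rewrite nbhsE; split=> [[V [oV Vp] VW] q pq|pW].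
  exact/VW/(oV p).
exists (square_le p) => //; split; last exact: square_le_refl.
by move=> q r qr pq; apply: square_le_trans pq qr.
Qed.

Lemma square_omega_well_filtered : omega_well_filtered square.
Proof.
apply: finite_omega_well_filtered.
  by apply/finite_seqP; exists (enum {: bool * bool});
    apply/seteqP; split=> // -[a b] _ /=; rewrite mem_enum.
have sep (p q : square) : ~~ square_le p q ->
    exists A : set square, A \in nbhs p /\ q \in ~` A.
  move=> npq; exists [set r | square_le p r]; split; rewrite inE /=; last exact/negP.
  exact/nbhs_square.
move=> p q pq; have : ~~ square_le p q \/ ~~ square_le q p.
  by move: p q pq => [[] []] [[] []] //=; auto.
by case=> /sep[A]; exists A; [left|right].
Qed.

Definition avoidance {X : Type} (F1 F2 : set X) (x : X) : square :=
  (`[< ~ F1 x >], `[< ~ F2 x >]).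

(** Each coordinate is the characteristic function of an open set, hence near
    any point it can only increase. *)
Lemma continuous_avoidance (X : topologicalType) (F1 F2 : set X) :
  closed F1 -> closed F2 -> continuous (avoidance F1 F2).
Proof.
move=> cl1 cl2 x W /nbhs_square xW.
have near_imp (F : set X) : closed F ->
    \forall z \near x, `[< ~ F x >] ==> `[< ~ F z >].
  move=> clF; have [Fx|nFx] := pselect (F x).
    by apply: nearW => z; apply/implyP => /asboolP.
  have : nbhs x (~` F) by apply: open_nbhs_nbhs; split=> //; exact: closed_openC.
  by apply: filterS => z nFz; apply/implyP => _; exact/asboolP.
apply: filterS2 (near_imp _ cl1) (near_imp _ cl2) => z z1 z2.
by apply: xW; rewrite /square_le z1.
Qed.

(** A generic point [y] of the image of [A] lies above a point with first
    coordinate [true] and one with second coordinate [true], so it is the top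
    corner; that corner is an open point, so it must then be attained on
    [A], at a point of neither [F1] nor [F2]. *)
Lemma WD_omega_sub_Irr_c (X : topologicalType) : WD_omega X `<=` Irr_c X.
Proof.
move=> A [clA wdA]; split=> //.
  (* Any admissible target excludes the empty set, which has no generic point. *)
  apply/set0P/negP => /eqP A0.
  have [|y []] := wdA square (cst (true, true)) square_omega_well_filtered.
    exact: cst_continuous.
  rewrite A0 image_set0 closure0 => y0 _.
  have : closure [set y] y by exact: spec_le_refl.
  by rewrite -y0.
move=> F1 F2 cl1 cl2 AF; apply: contrapT => /not_orP[].
move=> /existsNP[a /not_implyP[Aa nF1a]] /existsNP[b /not_implyP[Ab nF2b]].
have [y [yA _]] := wdA _ _ square_omega_well_filtered (continuous_avoidance cl1 cl2).
have le_y x : A x -> square_le (avoidance F1 F2 x) y.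
  move=> Ax; have : closure [set y] (avoidance F1 F2 x).
    by rewrite -yA; apply: subset_closure; exists x.
  move=> /(_ (square_le (avoidance F1 F2 x)))[|_ [->] //].
  exact/nbhs_square.
(* The top corner lies below [y], hence equals it; its upset is thus a
   neighbourhood of [y]. *)
have ytop : square_le (true, true) y.
  have /andP[/implyP/(_ (asboolT nF1a)) y1 _] := le_y _ Aa.
  have /andP[_ /implyP/(_ (asboolT nF2b)) y2] := le_y _ Ab.
  by rewrite /square_le y1 y2.
have : closure (avoidance F1 F2 @` A) y by rewrite yA; exact: spec_le_refl.
move=> /(_ (square_le (true, true)))[|_ [[x Ax <-] /andP[]]].
  by apply/nbhs_square => q; exact: square_le_trans.
by move=> /asboolP nF1x /asboolP nF2x; case: (AF x Ax).
Qed.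

Theorem proposition5p5 (X : topologicalType) (X_T0 : kolmogorov_space X) :
  [/\ Sc X `<=` Dc_omega X,
      Dc_omega X `<=` RD_omega X,
      RD_omega X `<=` WD_omega X &
      WD_omega X `<=` Irr_c X].
Proof.
split; [exact: Sc_sub_Dc_omega|exact: Dc_omega_sub_RD_omega| |].
  exact: RD_omega_sub_WD_omega.
exact: WD_omega_sub_Irr_c.
Qed.
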